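(* Let $l > 1$ be an integer. Then there exists a finite solvable composite degree group (CDG) $G$ such that the Fitting height of $G$ is $l$.
   Context: All groups are finite. For a group $G$, $\mathrm{Irr}(G)$ is the set of irreducible complex characters of $G$ and $\mathrm{cd}(G) = \{\chi(1) \mid \chi \in \mathrm{Irr}(G)\}$. A group $G$ is a composite degree group (CDG) if $1$ is the only prime power lying in $\mathrm{cd}(G)$; here $1$ counts as a prime power, so the condition says that no element of $\mathrm{cd}(G)$ has the form $p^a$ with $p$ prime and $a \geq 1$. The Fitting height of a solvable group $G$ is the least $n$ with $F_n(G) = G$, where $F_0(G) = 1$ and $F_{i+1}(G)/F_i(G)$ is the Fitting subgroup of $G/F_i(G)$. *)

(* Defs.v *)
From mathcomp Require Import all_boot all_order all_fingroup all_algebra.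
From mathcomp Require Import all_solvable all_field all_character.

Set Implicit Arguments.
Unset Strict Implicit.
Unset Printing Implicit Defensive.

Import GroupScope GRing.Theory.

Local Open Scope ring_scope.

Definition cd (gT : finGroupType) (G : {group gT}) : seq algC :=
  [seq 'chi[G]_i 1%g | i : Iirr G].

Definition composite_degree_group (gT : finGroupType) (G : {group gT}) : Prop :=
  forall p a : nat, prime p -> (0 < a)%N -> (p ^ a)%N%:R \notin cd G.

(* [coset H] is only a morphism on ['N(H)]; since [fitting_series G m] is normal in
   [G], the preimage below is contained in [G]. *)
Fixpoint fitting_series (gT : finGroupType) (G : {group gT}) (n : nat)
    : {group gT} :=
  if n is m.+1 then
    let H := fitting_series G m in (coset H @*^-1 'F(G / H))%G
  else 1%G.

Definition has_fitting_height (gT : finGroupType) (G : {group gT}) (n : nat)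
    : Prop :=
  fitting_series G n = G
  /\ forall m : nat, fitting_series G m = G -> (n <= m)%N.

(* Main.v *)
(** Given a composite degree group [G] of Fitting height [l > 0], let the cyclic
    group [C] of order 6, generated by the unit [17] of [Z/91], act by scalars on
    the free module [V] of functions from [G] to [Z/91], and put
    [X = V ><| (G x C)]. Both [Z/7] and [Z/13] contain the sixth roots of unity, so
    [z - 1] is invertible on [V] for every [z] in [C] other than [1]; hence a
    character of [X] nontrivial on [V] vanishes on such [z], and restricting it to
    [C] shows that its degree is divisible by 6. The other characters of [X] have
    the degrees of [G]. Moreover [G x C] acts faithfully on the 7-part and on the
    13-part of [V], which forces [F(X) = V], so that the height of [X] is [l + 1]. *)

Require Import Defs.
From HB Require Import structures.
From mathcomp Require Import all_boot all_order all_fingroup all_algebra.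
From mathcomp Require Import all_solvable all_field all_character.

Set Implicit Arguments.
Unset Strict Implicit.
Unset Printing Implicit Defensive.

Import GroupScope Order.TTheory GRing.Theory Num.Theory.
Local Open Scope ring_scope.

(** * Character degrees *)

Section Characters.

Variable gT : finGroupType.
Implicit Types G H K C V X : {group gT}.

(** Column orthogonality at [x] gives [|C_G(x)|] as the sum of all [|chi(x)|^2], and [|C_(G/H)(xH)|]
    as the sum over the characters with [H] in their kernel. Since [C_H(x) = 1], the first
    centralizer embeds in the second, so the remaining squares sum to at most 0. *)
Lemma irr_vanish_regular G H x (i : Iirr G) :
    x \in G -> H <| G -> 'C_H[x]%g = 1%g -> ~~ (H \subset cfker 'chi_i) ->
  'chi_i x = 0.
Proof.
move=> Gx nsHG regx ker'H; have [sHG nHG] := andP nsHG.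
have GHx: coset H x \in (G / H)%g by apply: mem_quotient.
have leC: (#|'C_G[x]| <= #|'C_(G / H)[coset H x]|)%N.
  have nHC: 'C_G[x]%g \subset 'N(H) by rewrite subIset ?nHG.
  have tiHC: (H :&: 'C_G[x] = 1)%g.
    by rewrite setIA (setIidPl sHG).
  rewrite (card_isog (quotient_isog nHC tiHC)) subset_leq_card //.
  rewrite (subset_trans (quotientI _ _ _)) // setIS //.
  by rewrite quotient_cent1s ?(subsetP nHG).
move: leC; rewrite -leC_nat.
move: (second_orthogonality_relation x Gx); rewrite mulrb class_refl => <-.
move: (second_orthogonality_relation (coset H x) GHx).
rewrite mulrb class_refl => <-.
rewrite -2!(eq_bigr _ (fun _ _ => normCK _)) sum_norm_irr_quo //.
rewrite (bigID (fun i => H \subset cfker 'chi[G]_i)) /= gerDl => le0.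
have ge0 (j : Iirr G) : ~~ (H \subset cfker 'chi_j) -> 0 <= `|'chi_j x| ^+ 2.
  by rewrite exprn_ge0.
have /eqP := le_anti (introT andP (conj le0 (sumr_ge0 _ ge0))).
rewrite psumr_eq0 // => /allP/(_ i (mem_index_enum i)); rewrite ker'H /=.
by rewrite expf_eq0 /= normr_eq0 => /eqP.
Qed.

(* Off the identity of [C] the character vanishes, so the multiplicity of the
   trivial character in its restriction to [C] is ['chi_i 1 / #|C|]. *)
Lemma irr1_divisible_regular G H C (i : Iirr G) :
    C \subset G -> H <| G -> {in C^#, forall z, 'C_H[z]%g = 1%g} ->
    ~~ (H \subset cfker 'chi_i) ->
  exists n, 'chi_i 1%g = (#|C| * n)%:R.
Proof.
move=> sCG nsHG regC ker'H.
have /natrP[n Dn]: '['Res[C] 'chi_i, 1] \in Num.nat.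
  by rewrite Cnat_cfdot_char ?cfRes_char ?irr_char ?rpred1.
exists n; rewrite natrM -Dn cfdotE mulVKf ?neq0CG //.
rewrite (big_setD1 1%g) //= big1 ?addr0 => [|z C1z].
  by rewrite cfResE // cfun11 conjC1 mulr1.
have [_ Cz] := setD1P C1z; have Gz := subsetP sCG z Cz.
by rewrite cfResE // (irr_vanish_regular Gz nsHG (regC z C1z)) ?mul0r.
Qed.

Lemma cdP G (c : algC) : reflect (exists i : Iirr G, c = 'chi_i 1%g) (c \in cd G).
Proof. by apply: (iffP mapP) => [[i _ ->]|[i ->]]; exists i; rewrite ?mem_enum. Qed.

Lemma composite_degree_dprod K C G :
    K \x C = G -> abelian C -> composite_degree_group K ->
  composite_degree_group G.
Proof.
move=> defG abC cdgK p a p_pr a_gt0; apply/cdP => -[i Di].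
have /cdP[] := cdgK p a p_pr a_gt0; rewrite Di -(inv_dprod_IirrK defG i).
case: (inv_dprod_Iirr defG i) => j k; exists j.
by rewrite dprod_IirrE cfDprod1 (lin_char1 (char_abelianP _ abC k)) mulr1.
Qed.

Lemma composite_degree_sdprod V H C X :
    V ><| H = X -> C \subset X -> {in C^#, forall z, 'C_V[z]%g = 1%g} ->
    (6 %| #|C|)%N -> composite_degree_group H -> composite_degree_group X.
Proof.
move=> defX sCX regC dvd6 cdgH p a p_pr a_gt0; apply/cdP => -[i Di].
have [nsVX _ _ _ _] := sdprod_context defX.
have [kerV | ker'V] := boolP (V \subset cfker 'chi_i).
  have /cdP[] := cdgH p a p_pr a_gt0; exists (Res_Iirr H i).
  by rewrite (sdprod_Res_IirrE defX) // cfRes1.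
have [n] := irr1_divisible_regular sCX nsVX regC ker'V.
rewrite -Di => /eqP; rewrite eqr_nat => /eqP Dpa.
(* Both 2 and 3 divide [p ^ a], so both would be equal to [p]. *)
have p_eq q : prime q -> (q %| 6)%N -> q = p.
  move=> q_pr q6; apply/eqP; rewrite -dvdn_prime2 //.
  suffices : (q %| p ^ a)%N by rewrite Euclid_dvdX // => /andP[].
  by rewrite Dpa dvdn_mulr // (dvdn_trans q6).
by have := p_eq 2 isT isT; rewrite -(p_eq 3).
Qed.

Lemma composite_degree_abelian G : abelian G -> composite_degree_group G.
Proof.
move=> abG p a p_pr a_gt0; apply/cdP=> -[i].
rewrite (lin_char1 (char_abelianP _ abG i)) => /eqP.
by rewrite pnatr_eq1 -(expn0 p) eqn_exp2l ?prime_gt1 // gtn_eqF.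
Qed.

End Characters.

Lemma composite_degree_isog (aT rT : finGroupType) (G : {group aT})
    (H : {group rT}) :
  G \isog H -> composite_degree_group G -> composite_degree_group H.
Proof.
rewrite isog_sym => /isogP[f injf im_f] cdgG p a p_pr a_gt0; apply/cdP=> -[i Di].
have isoHG: isom H G f by apply/isomP.
have /cdP[] := cdgG p a p_pr a_gt0.
by exists (isom_Iirr isoHG i); rewrite isom_IirrE cfIsom1.
Qed.

(** * The Fitting series *)

Section FittingSeries.

(** Each term is a subgroup functor compatible with morphisms, so normality and behaviour under
    images follow from the general theory of such functors. *)
Lemma fitting_series_gFun n :
  exists hF : GFunctor.pmap,
    forall (gT : finGroupType) (G : {group gT}),
      fitting_series G n = hF gT G :> {set gT}.
Proof.
elim: n => [|n [hF IHn]]; first by exists trivGfun_pgFun.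
by exists [pgFun of @Fitting %% hF] => gT G; rewrite /= /GFunctor.modulo -IHn.
Qed.

Lemma fitting_series_sub n (gT : finGroupType) (G : {group gT}) :
  fitting_series G n \subset G.
Proof. by have [hF ->] := fitting_series_gFun n; apply: gFsub. Qed.

Lemma fitting_series_normal n (gT : finGroupType) (G : {group gT}) :
  fitting_series G n <| G.
Proof. by have [hF ->] := fitting_series_gFun n; apply: gFnormal. Qed.

Lemma morphim_fitting_series n (aT rT : finGroupType) (D G : {group aT})
    (f : {morphism D >-> rT}) :
  G \subset D -> fitting_series G n = G ->
  fitting_series (f @* G)%G n = (f @* G)%G.
Proof.
move=> sGD defG; apply/val_inj/eqP.
rewrite eqEsubset fitting_series_sub /= -{1}defG.
by have [hF E] := fitting_series_gFun n; rewrite !E; apply: morphimF.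
Qed.

Lemma isog_fitting_series n (aT rT : finGroupType) (G : {group aT})
    (H : {group rT}) :
  G \isog H -> fitting_series G n = G -> fitting_series H n = H.
Proof.
move=> /isogP[f injf im_f] defG.
by rewrite -(group_inj im_f); apply: morphim_fitting_series.
Qed.

(** The third isomorphism from [G / H / (K / H)] to [G / K] carries [F] of the one to [F] of the
    other. This serves to compare the series of [G] with that of a quotient. *)
Lemma cosetpre_quotient_third (gT : finGroupType) (G H K : {group gT})
    (F : GFunctor.iso_map) :
    H <| G -> K <| G -> H \subset K ->
  coset K @*^-1 F _ (G / K)%g
    = coset H @*^-1 (coset (K / H) @*^-1 F _ (G / H / (K / H)))%g.
Proof.
move=> nsHG nsKG sHK; have [f injf im_f] := third_isom sHK nsHG nsKG.
pose A := (coset K @*^-1 F _ (G / K))%G.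
have sAG : A \subset G by rewrite sub_cosetpre_quo ?gFsub.
have sKA : K \subset A by apply: sub_cosetpre.
have nsHA : H <| A := normalS (subset_trans sHK sKA) sAG nsHG.
have nsKHA : (K / H <| A / H)%g by rewrite quotient_normal // (normalS sKA sAG).
rewrite -[LHS]/(gval A) -(quotientGK nsHA) -(quotientGK nsKHA).
congr (_ @*^-1 (_ @*^-1 _)).
have sFQ := gFsub F (G / H / (K / H))%G.
apply: (injm_morphim_inj injf) => //=; first by rewrite !quotientS.
by rewrite im_f // injmF // im_f // cosetpreK.
Qed.

(** The definition adds a layer at the top; here the bottom layer ['F(G)] is split off instead,
    which suits an induction through [G / 'F(G)]. *)
Lemma fitting_seriesS n (gT : finGroupType) (G : {group gT}) :
  fitting_series G n.+1
    = coset 'F(G) @*^-1 fitting_series (G / 'F(G))%G n :> {set gT}.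
Proof.
elim: n => [|n IHn].
  rewrite /= -kerE ker_coset.
  (* [G / 1] is only isomorphic to [G], so the Fitting subgroup is transported along the injective
     [coset 1]. *)
  have F1 : 'F(G / 1)%g = ('F(G) / 1)%g.
    by rewrite -injmF ?coset1_injm ?norms1.
  by rewrite F1 quotientGK // normal1.
have nsK := fitting_series_normal n.+1 G.
have sFK : 'F(G)%G \subset fitting_series G n.+1 by rewrite IHn sub_cosetpre.
rewrite {1}[fitting_series]lock /= -lock.
rewrite [LHS](cosetpre_quotient_third _ (Fitting_normal G) nsK sFK) /=.
congr (_ @*^-1 _).
have -> : (fitting_series G n.+1 / 'F(G) = fitting_series (G / 'F(G))%G n)%g.
  by rewrite IHn cosetpreK.
by [].
Qed.

Lemma quotient_fitting_series n (gT : finGroupType) (G : {group gT}) :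
  (fitting_series G n.+1 / 'F(G))%g = fitting_series (G / 'F(G))%G n.
Proof. by rewrite fitting_seriesS cosetpreK. Qed.

Lemma fitting_series_quotient n (gT : finGroupType) (G : {group gT}) :
  fitting_series G n.+1 = G <-> fitting_series (G / 'F(G))%G n = (G / 'F(G))%G.
Proof.
split=> [defG | defQ]; apply/val_inj.
  by apply: etrans (esym (quotient_fitting_series n G)) _; rewrite defG.
apply: etrans (fitting_seriesS n G) _.
by rewrite defQ quotientGK ?Fitting_normal.
Qed.

(** [N] lies in ['F(G)], so [G / 'F(G)] is a homomorphic image of [G / N]. *)
Lemma fitting_series_nilpotent_ext n (gT : finGroupType) (G N : {group gT}) :
    N <| G -> nilpotent N -> fitting_series (G / N)%G n = (G / N)%G ->
  fitting_series G n.+1 = G.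
Proof.
move=> nsNG nilN defQ; apply/fitting_series_quotient.
have sNF : N \subset 'F(G) := Fitting_max nsNG nilN.
have nsF := Fitting_normal G.
have := third_isog sNF nsNG nsF => /isog_fitting_series; apply.
apply: (@morphim_fitting_series _ _ _ 'N('F(G) / N)%G (G / N)%G) => //.
by apply: quotient_norms; apply: normal_norm.
Qed.

(** Modulo the nilpotent normal subgroup ['F(G) <*> C], the group [H] becomes [G / 'F(G)]. The
    successor matters: a nontrivial [C] has height 1 even when [G] is trivial. *)
Lemma fitting_series_dprod n (gT : finGroupType) (G C H : {group gT}) :
    G \x C = H -> nilpotent C -> fitting_series G n.+1 = G ->
  fitting_series H n.+1 = H.
Proof.
move=> defH nilC /fitting_series_quotient defQ.
have [_ _ cGC tiGC] := dprodP defH.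
have nsFG := Fitting_normal G.
have sFG := normal_sub nsFG.
have [nsGH nsCH] := dprod_normal2 defH.
have [sGH sCH] := (normal_sub nsGH, normal_sub nsCH).
have defN : 'F(G) \x C = 'F(G) <*> C.
  rewrite dprodEY ?(subset_trans cGC (centS sFG)) //.
  by apply/trivgP; rewrite -tiGC setSI.
have nilN : nilpotent ('F(G) <*> C) by rewrite (dprod_nil defN) Fitting_nil.
have nsNH : 'F(G) <*> C <| H.
  have nCF : C \subset 'N('F(G)) by rewrite cents_norm // (subset_trans cGC) ?centS.
  have nGC : G \subset 'N(C) by rewrite cents_norm // centsC.
  rewrite -(dprodWY defH) /normal genS ?setSU //= join_subG.
  by rewrite !normsY ?normG //; apply: normal_norm.
apply: (fitting_series_nilpotent_ext nsNH nilN).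
have nNG : G \subset 'N('F(G) <*> C) := subset_trans sGH (normal_norm nsNH).
have defHN : (G / ('F(G) <*> C) = H / ('F(G) <*> C))%g.
  apply/eqP; rewrite eqEsubset quotientS //= -(dprodW defH).
  rewrite quotientMl // mul_subG // (subset_trans _ (sub1G _)) //.
  by rewrite quotient_sub1 ?joing_subr // (subset_trans _ (normG _)) ?joing_subr.
rewrite -(group_inj defHN).
apply: isog_fitting_series defQ.
(* By the modular law, the second isomorphism theorem yields exactly [G / 'F(G)]. *)
have defI : (('F(G) <*> C) :&: G)%g = 'F(G).
  by rewrite -(dprodW defN) -group_modl // setIC tiGC mulg1.
by have := second_isog nNG; rewrite /= defI.
Qed.

End FittingSeries.

(* The [p]- and [p']-parts of ['F(X)] centralize each other, and they contain [a]
   and [b] respectively. *)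
Lemma Fitting_eq_self_centralizing (gT : finGroupType) (p : nat)
    (X V : {group gT}) (a b : gT) :
    V <| X -> nilpotent V -> a \in V -> b \in V -> p.-elt a -> p^'.-elt b ->
    'C_X[a]%g \subset V -> 'C_X[b]%g \subset V ->
  'F(X)%g = V.
Proof.
move=> nsVX nilV Va Vb pa p'b sCaV sCbV.
have sVF := Fitting_max nsVX nilV; have sFX := Fitting_sub X.
have nilF := Fitting_nil X.
have /dprodP[_ defF cpp' _] := nilpotent_pcoreC p nilF.
have mem_pcore pi x : x \in V -> pi.-elt x -> x \in 'O_pi('F(X))%g.
  move=> Vx pix; rewrite -cycle_subG (sub_Hall_pcore (nilpotent_pcore_Hall pi nilF)) //.
  by rewrite cycle_subG (subsetP sVF).
apply/eqP; rewrite eqEsubset sVF andbT -defF mul_subG //.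
  apply: subset_trans sCbV; rewrite subsetI (subset_trans (pcore_sub _ _)) //=.
  rewrite centsC in cpp'; rewrite (subset_trans cpp') // -cent_cycle centS //.
  by rewrite cycle_subG mem_pcore.
apply: subset_trans sCaV; rewrite subsetI (subset_trans (pcore_sub _ _)) //=.
by rewrite (subset_trans cpp') // -cent_cycle centS // cycle_subG mem_pcore.
Qed.

(** * The extension step *)

(* The reason is that 17 has order 6 modulo both 7 and 13. *)
Lemma unit17 (k : 'Z_6) : k != 0 -> (17%:R ^+ k - 1 : 'Z_91) \is a GRing.unit.
Proof.
have E2 : 17%:R ^+ 2 = 16%:R :> 'Z_91 by apply/eqP; vm_compute.
have E3 : 17%:R ^+ 3 = 90%:R :> 'Z_91 by rewrite exprS E2; apply/eqP; vm_compute.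
have E4 : 17%:R ^+ 4 = 74%:R :> 'Z_91 by rewrite exprS E3; apply/eqP; vm_compute.
have E5 : 17%:R ^+ 5 = 75%:R :> 'Z_91 by rewrite exprS E4; apply/eqP; vm_compute.
case: k => [[|[|[|[|[|[|k]]]]]]] //= ltk6 _; rewrite ?expr1 ?E2 ?E3 ?E4 ?E5.
(* The differences 16, 15, 89, 73 and 74 are coprime to 91. *)
all: by rewrite -natrB // unitZpE.
Qed.

Section AffineExtension.

Variable gT : finGroupType.

(** An embedding of the additive group ['Z_6] into the units of ['Z_91]. *)
Definition unit6 (k : 'Z_6) : 'Z_91 := 17%:R ^+ k.

Lemma unit6M k l : unit6 (k * l)%g = unit6 k * unit6 l.
Proof.
have X6 : 17%:R ^+ 6 = 1 :> 'Z_91 by apply/eqP; vm_compute.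
by rewrite -exprD /unit6 /= -[in RHS](expr_mod _ X6).
Qed.

Lemma unit6_1 : unit6 1%g = 1.
Proof. by []. Qed.

(** The left regular representation of [gT], twisted by the scalar of the ['Z_6] component. *)
Definition scaled_translate (h : gT * 'Z_6) (v : {ffun gT -> 'Z_91}) :
    {ffun gT -> 'Z_91} :=
  [ffun x => unit6 h.2 * v (h.1^-1 * x)%g].

Lemma scaled_translate1 v : scaled_translate 1%g v = v.
Proof. by apply/ffunP=> x; rewrite ffunE /= invg1 mul1g unit6_1 mul1r. Qed.

Lemma scaled_translateM g h v :
  scaled_translate (g * h)%g v = scaled_translate g (scaled_translate h v).
Proof. by apply/ffunP=> x; rewrite !ffunE /= invMg mulgA unit6M mulrA. Qed.

Lemma scaled_translateD h : {morph scaled_translate h : v w / v + w}.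
Proof. by move=> v w; apply/ffunP=> x; rewrite !ffunE mulrDr. Qed.

Lemma scaled_translate0 h : scaled_translate h 0 = 0.
Proof. by apply/ffunP=> x; rewrite !ffunE mulr0. Qed.

(** * The affine group and its subgroups *)

Definition affine : Type := ({ffun gT -> 'Z_91} * (gT * 'Z_6))%type.

HB.instance Definition _ := Finite.on affine.

(** The pair [(v, h)] stands for the map sending [w] to [v + h w], and the law is composition. *)
Definition affine_mul (x y : affine) : affine :=
  (x.1 + scaled_translate x.2 y.1, x.2 * y.2)%g.

Definition affine_one : affine := (0, 1%g).

Definition affine_inv (x : affine) : affine :=
  (- scaled_translate x.2^-1 x.1, x.2^-1)%g.

Lemma affine_mulA : associative affine_mul.
Proof.
move=> x y z; congr (_, _) => /=; last by rewrite mulgA.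
by rewrite scaled_translateD scaled_translateM addrA.
Qed.

Lemma affine_mul1 : left_id affine_one affine_mul.
Proof. by case=> v h; rewrite /affine_mul /= scaled_translate1 add0r mul1g. Qed.

Lemma affine_mulV : left_inverse affine_one affine_inv affine_mul.
Proof. by case=> v h; rewrite /affine_mul /= addNr mulVg. Qed.

HB.instance Definition _ :=
  Finite_isGroup.Build affine affine_mulA affine_mul1 affine_mulV.


Lemma affine_mulE (x y : affine) :
  (x * y)%g = (x.1 + scaled_translate x.2 y.1, (x.2 * y.2)%g) :> affine.
Proof. by []. Qed.

Definition affine_linear (x : affine) : gT * 'Z_6 := x.2.

Lemma affine_linearM : {in [set: affine] &, {morph affine_linear : x y / (x * y)%g}}.
Proof. by []. Qed.
Canonical affine_linear_morphism := Morphism affine_linearM.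

Definition affine_lift (h : gT * 'Z_6) : affine := (0, h).

Lemma affine_liftM : {in [set: gT * 'Z_6] &, {morph affine_lift : g h / (g * h)%g}}.
Proof.
by move=> g h _ _; rewrite affine_mulE /= scaled_translate0 addr0.
Qed.
Canonical affine_lift_morphism := Morphism affine_liftM.

Lemma injm_affine_lift : 'injm affine_lift.
Proof. by apply/injmP=> g h _ _ []. Qed.

(** In [V ><| (G x C)], these four groups are [V], the complement [G x C] fixing the zero function,
    and its factors [G] and [C]. *)
Definition translations : {group affine} := 'ker affine_linear.
Definition point_stabilizer : {group affine} :=
  (affine_lift @* setX [set: gT] [set: 'Z_6])%G.
Definition rotations : {group affine} := (affine_lift @* setX [set: gT] 1)%G.
Definition scalings : {group affine} := (affine_lift @* setX 1 [set: 'Z_6])%G.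

Lemma mem_translations x : (x \in translations) = (x.2 == 1%g).
Proof. by apply/kerP/eqP => //; rewrite inE. Qed.

Lemma mem_point_stabilizer x : (x \in point_stabilizer) = (x.1 == 0).
Proof.
apply/morphimP/eqP => [[h _ _ ->] // | x0]; exists x.2; rewrite ?inE //.
by case: x x0 => v h /= ->.
Qed.

Lemma mem_scalings x : x \in scalings -> exists k, x = affine_lift (1%g, k).
Proof.
by case/morphimP => [[g k]] _ /setXP[/set1P/= -> _] ->; exists k.
Qed.

Lemma affine_sdprod : translations ><| point_stabilizer = [set: affine].
Proof.
have nV : [set: affine] \subset 'N(translations) by rewrite ker_norm.
rewrite sdprodE ?(subset_trans (subsetT _) nV) //.
  apply/setP=> x; rewrite !inE; apply/mulsgP.
  exists (x.1, 1%g) (0, x.2); rewrite ?mem_translations ?mem_point_stabilizer //.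
  by case: x => v h; rewrite affine_mulE /= scaled_translate0 addr0 mul1g.
apply/trivgP/subsetP=> -[v h]; rewrite inE mem_translations mem_point_stabilizer.
by case/andP=> /eqP/= -> /eqP/= ->; rewrite inE.
Qed.

Lemma point_stabilizer_dprod : rotations \x scalings = point_stabilizer.
Proof.
exact: (injm_dprod (subsetT _) injm_affine_lift (setX_dprod _ _)).
Qed.

Lemma isog_rotations : [set: gT] \isog rotations.
Proof.
exact: isog_trans (isog_setX1 _ _) (sub_isog (subsetT _) injm_affine_lift).
Qed.

Lemma card_scalings : #|scalings| = 6.
Proof. by rewrite card_injm ?injm_affine_lift ?subsetT // cardsX cards1 cardsT card_ord. Qed.

Lemma scalings_abelian : abelian scalings.
Proof.
apply: morphim_abelian; rewrite -(isog_abelian (isog_set1X _ [set: 'Z_6])).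
exact: Zp_abelian.
Qed.

Lemma translations_abelian : abelian translations.
Proof.
apply/centsP=> -[v g] + [w h]; rewrite !mem_translations => /eqP/= -> /eqP/= ->.
by rewrite /commute !affine_mulE /= !scaled_translate1 addrC.
Qed.

(** For nonzero [k], the unit [17 ^+ k - 1] would annihilate [c]. *)
Lemma unit6_regular k (c : 'Z_91) : unit6 k * c = c -> c != 0 -> k = 0.
Proof.
move=> fix_c; apply: contraNeq => /unit17 Uk.
by rewrite -(mulKr Uk c) mulrBl mul1r -/(unit6 k) fix_c subrr mulr0.
Qed.

Lemma scalings_regular : {in scalings^#, forall z, 'C_translations[z]%g = 1%g}.
Proof.
move=> z /setD1P[nz_z /mem_scalings[k Dz]]; apply/trivgP/subsetP=> -[v h].
rewrite inE mem_translations => /andP[/eqP/= -> /cent1P].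
rewrite Dz /commute !affine_mulE  /= scaled_translate1 addr0 add0r.
case=> /ffunP fix_v _; rewrite inE; apply/eqP; congr (_, _).
apply/ffunP=> x; rewrite [RHS]ffunE; apply: contraNeq nz_z => /(unit6_regular _) k0.
have := fix_v x; rewrite !ffunE /= invg1 mul1g => /esym/k0 Dk.
by rewrite Dz Dk.
Qed.

(** * The Fitting subgroup of the affine group *)

Definition point_translation (c : 'Z_91) : affine :=
  ([ffun x => if x == 1%g then c else 0], 1%g).

Lemma point_translation_in c : point_translation c \in translations.
Proof. by rewrite mem_translations. Qed.

Lemma point_translationX c n :
  (point_translation c ^+ n)%g = point_translation (c *+ n).
Proof.
elim: n => [|n IHn].
  by congr (_, _); apply/ffunP=> x; rewrite !ffunE; case: eqP.
rewrite expgS IHn affine_mulE /= scaled_translate1; congr (_, _);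
  last by rewrite mul1g.
by apply/ffunP=> x; rewrite !ffunE; case: eqP; rewrite ?addr0 ?mulrS.
Qed.

Lemma point_translation_dvd_order c n :
  c *+ n = 0 -> (#[point_translation c] %| n)%N.
Proof.
move=> cn0; rewrite order_dvdn point_translationX cn0; apply/eqP; congr (_, _).
by apply/ffunP=> x; rewrite !ffunE; case: eqP.
Qed.

(** Conjugation by an element with linear part [(g, k)] moves the support from 1 to [g] and
    multiplies the value by [17 ^+ k], so commuting forces [g = 1] and then [k = 0]. *)
Lemma cent_point_translation (c : 'Z_91) :
  c != 0 -> 'C[point_translation c]%g \subset translations.
Proof.
move=> nz_c; apply/subsetP=> -[v [g k]] /cent1P.
rewrite /commute !affine_mulE /= mul1g mulg1 scaled_translate1 addrC.
case=> /addIr/ffunP fix_c; have := fix_c g; rewrite !ffunE /= mulVg eqxx.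
have [-> | _ uc0] := eqVneq.
  by move/unit6_regular/(_ nz_c) ->; rewrite mem_translations.
case/eqP: nz_c.
by rewrite -[c]mul1r -unit6_1 -(mulVg k) unit6M -mulrA uc0 mulr0.
Qed.

(** In ['Z_91], 13 has additive order 7 and 7 has additive order 13; they give a 7-element and a
    7'-element whose centralizers lie in [translations]. *)
Lemma Fitting_affine : 'F([set: affine])%g = translations.
Proof.
have [nsV _ _ _ _] := sdprod_context affine_sdprod.
have c13 : 13%:R *+ 7 = 0 :> 'Z_91 by apply/eqP; vm_compute.
have c7 : 7%:R *+ 13 = 0 :> 'Z_91 by apply/eqP; vm_compute.
have nz13 : 13%:R != 0 :> 'Z_91 by vm_compute.
have nz7 : 7%:R != 0 :> 'Z_91 by vm_compute.
have p7 : 7%N.-nat 7%N by [].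
have p13 : 7%N^'.-nat 13%N by [].
apply: (Fitting_eq_self_centralizing nsV (abelian_nil translations_abelian)
          (point_translation_in 13%:R) (point_translation_in 7%:R)
          (pnat_dvd (point_translation_dvd_order c13) p7)
          (pnat_dvd (point_translation_dvd_order c7) p13)).
  by rewrite setTI cent_point_translation.
by rewrite setTI cent_point_translation.
Qed.

End AffineExtension.

(** * Raising the height by one *)

Lemma affine_height_step (gT : finGroupType) (l : nat) :
    [/\ solvable [set: gT], composite_degree_group [set: gT]%G
      & has_fitting_height [set: gT]%G l.+1] ->
  [/\ solvable [set: affine gT], composite_degree_group [set: affine gT]%G
    & has_fitting_height [set: affine gT]%G l.+2].
Proof.
case=> solG cdgG [fullG minG].
have defX := affine_sdprod gT; have defH := point_stabilizer_dprod gT.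
have [nsV _ _ _ _] := sdprod_context defX.
have [isoG abC] := (isog_rotations gT, scalings_abelian gT).
have isoQ : point_stabilizer gT \isog [set: affine gT] / 'F([set: affine gT]).
  by have := sdprod_isog defX; rewrite Fitting_affine.
have isoH : rotations gT \isog point_stabilizer gT / scalings gT.
  have [_ _ cGC _] := dprodP defH.
  by apply: sdprod_isog; rewrite -dprodEsd 1?dprodC // centsC.
split.
- rewrite (series_sol nsV) abelian_sol ?translations_abelian //=.
  rewrite -(isog_sol (sdprod_isog defX)).
  have [_ nsC] := dprod_normal2 defH.
  by rewrite (series_sol nsC) abelian_sol //= -(isog_sol isoH) -(isog_sol isoG).
- apply: (composite_degree_sdprod defX (subsetT _) (@scalings_regular gT)).
    by rewrite card_scalings.
  exact: composite_degree_dprod defH abC (composite_degree_isog isoG cdgG).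
split.
  apply/fitting_series_quotient/(isog_fitting_series isoQ).
  apply: fitting_series_dprod defH (abelian_nil abC) _.
  exact: isog_fitting_series isoG fullG.
(* Height 0 is excluded because [scalings] is nontrivial. Otherwise the bound descends to the
   quotient by the Fitting subgroup, which is [G x C], and then to its image [G]. *)
case=> [/(congr1 val)/= triv | m /fitting_series_quotient fullQ].
  have := subsetT (scalings gT); rewrite -triv => /subset_leq_card.
  by rewrite card_scalings cards1.
rewrite ltnS; apply: minG.
apply: (@isog_fitting_series _ _ _ (rotations gT)); first by rewrite isog_sym.
apply: (@isog_fitting_series _ _ _ (point_stabilizer gT / scalings gT)%G).
  by rewrite isog_sym.
have [_ nsC] := dprod_normal2 defH.
apply: (morphim_fitting_series (coset_morphism _)); first exact: normal_norm.
by apply: isog_fitting_series fullQ; rewrite isog_sym.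
Qed.

Local Close Scope ring_scope.
Local Close Scope group_scope.

Theorem theorem1p1 (l : nat) (hl : 1 < l) :
  exists (gT : finGroupType) (G : {group gT}),
    [/\ solvable G, composite_degree_group G & has_fitting_height G l].
Proof.
(* The extension step acts on whole types and positive heights, hence the full group and
   [l.-1.+1]. *)
suffices [gT cdg_gT] : exists gT : finGroupType,
    [/\ solvable [set: gT], composite_degree_group [set: gT]%G
      & has_fitting_height [set: gT]%G l.-1.+1].
  by exists gT, [set: gT]%G; rewrite prednK ?(ltnW hl) in cdg_gT.
elim: l.-1 => [|n [gT /affine_height_step IHn]]; last by exists (affine gT).
(* Any nontrivial abelian group could start the induction, at height 1. *)
exists 'Z_6.
have abZ : abelian [set: 'Z_6] := Zp_abelian _.
split; [exact: abelian_sol | exact: composite_degree_abelian |].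
split.
  apply/fitting_series_quotient/val_inj => /=.
  by rewrite nilpotent_Fitting ?abelian_nil // trivg_quotient.
case=> // /(congr1 (fun G : {group _} => #|G|)).
by rewrite /= cards1 cardsT card_ord.
Qed.
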